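(* Let $P,Q$ be probability measures on $(\Omega,\mathcal{M})$ and $\alpha\in\mathbb{R}\setminus\{0,1\}$. Then $$R_\alpha(Q\|P)=\sup_{g\in B(\Omega)}\Big\{\frac{1}{\alpha-1}\log\Big[\int e^{(\alpha-1)g}\,dQ\Big]-\frac1\alpha\log\Big[\int e^{\alpha g}\,dP\Big]\Big\},$$ where $B(\Omega)$ is the set of bounded measurable real-valued functions on $\Omega$.
   Context: Rényi divergence: let $\nu$ be a $\sigma$-finite positive measure with $dP=p\,d\nu$, $dQ=q\,d\nu$. For $\alpha\in(0,1)$, $R_\alpha(Q\|P)=\frac{1}{\alpha(\alpha-1)}\log\int_{p>0}q^\alpha p^{1-\alpha}\,d\nu$; for $\alpha>1$, the same formula if $Q\ll P$ and $R_\alpha(Q\|P)=+\infty$ if $Q\not\ll P$; for $\alpha<0$, $R_\alpha(Q\|P)=R_{1-\alpha}(P\|Q)$. *)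

(* Defs.v *)
From HB Require Import structures.
From mathcomp Require Import all_boot all_order all_algebra.
From mathcomp Require Import all_classical all_reals all_analysis.
Set Implicit Arguments. Unset Strict Implicit. Unset Printing Implicit Defensive.
Import Order.TTheory GRing.Theory Num.Theory.
Local Open Scope classical_set_scope.
Local Open Scope ring_scope.
Local Open Scope ereal_scope.

Definition renyi_int d (T : measurableType d) (R : realType)
  (nu : set T -> \bar R) (p q : T -> R) (a : R) : \bar R :=
  \int[nu]_(x in [set x | (0 < p x)%R]) ((q x) `^ a * (p x) `^ (1 - a))%:E.

(* Renyi divergence R_a(Q||P), where dP = p dnu and dQ = q dnu.
   For a in {0,1} (not covered by the definition) an arbitrary value 0. *)
Definition renyi d (T : measurableType d) (R : realType)
  (nu P Q : set T -> \bar R) (p q : T -> R) (a : R) : \bar R :=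
  if ((0 < a) && (a < 1))%R then
    ((a * (a - 1))^-1)%:E * lne (renyi_int nu p q a)
  else if (1 < a)%R then
    (if pselect (Q `<< P) then ((a * (a - 1))^-1)%:E * lne (renyi_int nu p q a)
     else +oo)
  else if (a < 0)%R then
    (* R_a(Q||P) = R_{1-a}(P||Q) *)
    (if pselect (P `<< Q) then
       (((1 - a) * ((1 - a) - 1))^-1)%:E * lne (renyi_int nu q p (1 - a))
     else +oo)
  else 0.

Definition bounded_measurable d (T : measurableType d) (R : realType)
  (g : T -> R) : Prop :=
  measurable_fun setT g /\ exists M : R, forall x, (`|g x| <= M)%R.

Definition renyi_obj d (T : measurableType d) (R : realType)
  (P Q : set T -> \bar R) (a : R) (g : T -> R) : \bar R :=
  ((a - 1)^-1)%:E * lne (\int[Q]_x (expR ((a - 1) * g x))%:E)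
  - (a^-1)%:E * lne (\int[P]_x (expR (a * g x))%:E).

(* Main.v *)
Require Import Defs.
From HB Require Import structures.
From mathcomp Require Import all_boot all_order all_algebra.
From mathcomp Require Import ring lra.
From mathcomp Require Import all_classical all_reals all_analysis.
From mathcomp Require Import measurable_realfun.
Import Order.TTheory GRing.Theory Num.Theory.
Local Open Scope classical_set_scope.
Local Open Scope ring_scope.
Local Open Scope ereal_scope.

(** Put h = q^a p^(1-a), I = \int h dnu and K = 1 / (a (a - 1)), and for a bounded
    g let A = \int e^((a-1)g) q dnu and B = \int e^(ag) p dnu, so that the
    objective is K (a ln A + (1 - a) ln B).

    Upper bound: for 0 < a < 1 Hoelder's inequality applied to
    h = (e^((a-1)g) q)^a (e^(ag) p)^(1-a) gives I <= A^a B^(1-a); for a > 1 and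
    Q << P it is applied to e^((a-1)g) q = h^(1/a) (e^(ag) p)^(1-1/a) and gives
    A <= I^(1/a) B^(1-1/a).

    Lower bound: the formal maximiser is ln (q / p), so take g = ln w with w the
    ratio q / p truncated to [l, u]. For 0 < a < 1, comparing integrands gives
    A <= I + u^(a-1) and B <= I + l^a. For a > 1 it gives B <= A + l^a, while A
    dominates the integral of min(u, q/p)^(a-1) q, which increases to I. When
    Q << P fails, multiples of the indicator of a P-null set charged by Q make
    the objective unbounded. The case a < 0 is the case 1 - a > 1 with P and Q
    exchanged and g replaced by -g. *)

(** * Comparing scaled extended logarithms with reals *)

Section scaled_log.
Context {R : realType}.
Implicit Types (r k : R) (x : \bar R).

(** This and the next three lemmas move a comparison with [k * lne x] onto [x] itself, so that the
    values [lne 0 = -oo] and [lne +oo = +oo] need no separate treatment. The sign of [k] decides the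
    direction. *)
Lemma lt_pmul_lne k r x : (0 < k)%R -> 0 <= x ->
  (r%:E < k%:E * lne x) = ((expR (r / k))%:E < x).
Proof.
move=> k0 x0.
rewrite -lte_pdivrMl// -EFinM mulrC -[in LHS]lte_expeR lneK//.
by rewrite in_itv/= x0 leey.
Qed.

Lemma pmul_lne_lt k r x : (0 < k)%R -> 0 <= x ->
  (k%:E * lne x < r%:E) = (x < (expR (r / k))%:E).
Proof.
move=> k0 x0.
rewrite -lte_pdivlMl// -EFinM mulrC -[in LHS]lte_expeR lneK//.
by rewrite in_itv/= x0 leey.
Qed.

Lemma lt_nmul_lne k r x : (k < 0)%R -> 0 <= x ->
  (r%:E < k%:E * lne x) = (x < (expR (r / k))%:E).
Proof.
move=> k0 x0.
rewrite -[k]opprK EFinN mulNe lteNr -EFinN pmul_lne_lt ?oppr_gt0// invrN.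
by rewrite mulrNN opprK.
Qed.

Lemma nmul_lne_lt k r x : (k < 0)%R -> 0 <= x ->
  (k%:E * lne x < r%:E) = ((expR (r / k))%:E < x).
Proof.
move=> k0 x0.
rewrite -[k]opprK EFinN mulNe lteNl -EFinN lt_pmul_lne ?oppr_gt0// invrN.
by rewrite mulrNN opprK.
Qed.

(** Lower bounds on the supremum are proved through real approximations from below, which also
    covers an infinite left-hand side. *)
Lemma le_lt_EFin x y : (forall r, r%:E < x -> r%:E <= y) -> x <= y.
Proof.
case: x => [r| |] h; last by rewrite leNye.
  apply/lee_subgt0Pr => e e0; rewrite -EFinB; apply: h.
  by rewrite lte_fin ltrBlDr ltrDl.
case: y h => [s| |] h; [|by rewrite leey|by have := h 0%R (ltry _)].
by have := h (s + 1)%R (ltry _); rewrite lee_fin gerDl ler10.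
Qed.

End scaled_log.

(** * Hoelder's inequality from the weighted AM-GM inequality *)

Section weighted_hoelder.
Context {R : realType}.
Implicit Types (t u v s w : R).

(** Young's inequality for [u^t] and [v^(1-t)] with conjugate exponents [1/t] and [1/(1-t)]. *)
Lemma weighted_AMGM t u v : (0 < t < 1)%R -> (0 <= u)%R -> (0 <= v)%R ->
  (u `^ t * v `^ (1 - t) <= t * u + (1 - t) * v)%R.
Proof.
move=> /andP[t0 t1] u0 v0.
have t1' : (0 < 1 - t)%R by rewrite subr_gt0.
have := @conjugate_powR R (u `^ t)%R (v `^ (1 - t))%R t^-1%R (1 - t)^-1%R
  (powR_ge0 _ _) (powR_ge0 _ _).
rewrite !invr_gt0 !invrK -!powRrM !mulfV ?gt_eqF// !powRr1//.
rewrite [(u * t)%R]mulrC [(v * _)%R]mulrC; apply => //.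
by rewrite addrC subrK.
Qed.

(** AM-GM for the normalised values [u/s] and [v/w]. The right-hand side is linear in [u] and [v],
    hence ready to integrate. *)
Lemma scaled_weighted_AMGM t u v s w : (0 < t < 1)%R ->
    (0 <= u)%R -> (0 <= v)%R -> (0 < s)%R -> (0 < w)%R ->
  (u `^ t * v `^ (1 - t) <=
   s `^ t * w `^ (1 - t) * (t / s) * u
   + s `^ t * w `^ (1 - t) * ((1 - t) / w) * v)%R.
Proof.
move=> t01 u0 v0 s0 w0.
have us0 : (0 <= u / s)%R by rewrite divr_ge0// ltW.
have vw0 : (0 <= v / w)%R by rewrite divr_ge0// ltW.
have {1}-> : u = (s * (u / s))%R by rewrite mulrC divfK// gt_eqF.
have {1}-> : v = (w * (v / w))%R by rewrite mulrC divfK// gt_eqF.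
rewrite (powRM _ (ltW s0) us0) (powRM _ (ltW w0) vw0) mulrACA.
rewrite -[X in (_ <= X + _)%R]mulrA -[X in (_ <= _ + X)%R]mulrA -mulrDr.
rewrite ler_wpM2l ?mulr_ge0 ?powR_ge0//.
rewrite mulrAC -mulrA [X in (_ <= _ + X)%R]mulrAC -[X in (_ <= _ + X)%R]mulrA.
exact: weighted_AMGM.
Qed.

Context {d} {T : measurableType d} (mu : {measure set T -> \bar R}).
(** Integrating the scaled AM-GM inequality bounds the left side by [c t + c (1 - t) = c]. Positive
    real bounds [s] and [w] in place of the integrals avoid the cases of zero or infinite norms. *)
Lemma weighted_hoelder t s w (f g : T -> R) : (0 < t < 1)%R ->
    measurable_fun setT f -> measurable_fun setT g ->
    (forall x, 0 <= f x)%R -> (forall x, 0 <= g x)%R ->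
    (0 < s)%R -> (0 < w)%R ->
    \int[mu]_x (f x)%:E <= s%:E -> \int[mu]_x (g x)%:E <= w%:E ->
  \int[mu]_x (f x `^ t * g x `^ (1 - t))%:E <= (s `^ t * w `^ (1 - t))%:E.
Proof.
move=> t01 mf mg f0 g0 s0 w0 fs gw.
have /andP[t0 t1] := t01.
have t1' : (0 < 1 - t)%R by rewrite subr_gt0.
set c := (s `^ t * w `^ (1 - t))%R.
have c0 : (0 < c)%R by rewrite mulr_gt0// powR_gt0.
have k10 : (0 <= c * (t / s))%R by rewrite mulr_ge0 ?divr_ge0 ?ltW.
have k20 : (0 <= c * ((1 - t) / w))%R by rewrite mulr_ge0 ?divr_ge0 ?ltW.
have mpow h y : measurable_fun setT h ->
    measurable_fun setT (fun x : T => h x `^ y : R)%R.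
  by move=> mh; apply: (measurableT_comp (measurable_powR y)).
apply: (@le_trans _ _ (\int[mu]_x ((c * (t / s))%:E * (f x)%:E +
    (c * ((1 - t) / w))%:E * (g x)%:E))).
  apply: ge0_le_integral => //=.
  - by move=> x _; rewrite lee_fin mulr_ge0 ?powR_ge0.
  - by apply/measurable_EFinP/measurable_funM; exact: mpow.
  - by apply: emeasurable_funD; apply: measurable_funeM; exact/measurable_EFinP.
  - by move=> x _; rewrite -!EFinM -EFinD lee_fin scaled_weighted_AMGM.
rewrite ge0_integralD//=; last 4 first.
- by move=> x _; rewrite mule_ge0// lee_fin.
- by apply: measurable_funeM; exact/measurable_EFinP.
- by move=> x _; rewrite mule_ge0// lee_fin.
- by apply: measurable_funeM; exact/measurable_EFinP.
rewrite !ge0_integralZl//=; last 4 first.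
- exact/measurable_EFinP.
- by move=> x _; rewrite lee_fin.
- exact/measurable_EFinP.
- by move=> x _; rewrite lee_fin.
apply: (@le_trans _ _ ((c * (t / s))%:E * s%:E + (c * ((1 - t) / w))%:E * w%:E)).
  by apply: leeD; apply: lee_wpmul2l => //; rewrite lee_fin.
rewrite -!EFinM -EFinD lee_fin le_eqVlt; apply/orP; left; apply/eqP.
by field; rewrite !gt_eqF.
Qed.

End weighted_hoelder.

(** * Integration against a density, and bounded exponentials *)

(** The Radon-Nikodym derivative of [mu] has the same integral as [p] over every measurable set, so
    the two agree almost everywhere and change of variables applies with [p]. *)
Lemma integral_density {d} {T : measurableType d} {R : realType}
    (mu : {finite_measure set T -> \bar R})
    (nu : {sigma_finite_measure set T -> \bar R}) (p : T -> R) :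
    measurable_fun setT p -> (forall x, 0 <= p x)%R ->
    (forall A, measurable A -> mu A = \int[nu]_(x in A) (p x)%:E) ->
  forall (E : set T) (f : T -> R), measurable E -> (forall x, 0 <= f x)%R ->
    measurable_fun setT f ->
  \int[mu]_(x in E) (f x)%:E = \int[nu]_(x in E) (f x * p x)%:E.
Proof.
move=> mp p0 muE E f mE f0 mf.
have numu : mu `<< nu.
  apply/null_content_dominatesP => A mA A0.
  by rewrite muE// null_set_integral//; exact/measurable_EFinP/measurable_funTS.
have mfE : measurable_fun E (EFin \o f) by exact/measurable_EFinP/measurable_funTS.
have f0' x : 0 <= (EFin \o f) x by rewrite lee_fin.
rewrite -(Radon_Nikodym_SigmaFinite.change_of_variables numu f0' mE mfE)//.
have mRN := measurable_int _ (Radon_Nikodym_SigmaFinite.f_integrable numu).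
apply: ge0_ae_eq_integral => //=.
- by apply: emeasurable_funM => //; exact: measurable_funTS mRN.
- apply/measurable_EFinP/measurable_funM; exact: measurable_funTS.
- by move=> x _; rewrite mule_ge0 ?lee_fin ?Radon_Nikodym_SigmaFinite.f_ge0.
- by move=> x _; rewrite lee_fin mulr_ge0.
under [X in ae_eq _ _ _ X]eq_fun do rewrite EFinM.
apply: ae_eqe_mul2l; apply: integral_ae_eq => //.
- apply: (integrableS measurableT) => //.
  exact: Radon_Nikodym_SigmaFinite.f_integrable.
- exact/measurable_EFinP/measurable_funTS.
- by move=> A AE mA; rewrite -muE// -Radon_Nikodym_SigmaFinite.f_integral.
Qed.

(** The integrand lies between two positive constants and [mu] has mass 1. Hence both logarithms in
    the objective are finite. *)
Lemma integral_expR_bounded {d} {T : measurableType d} {R : realType}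
    (mu : probability T R) (c : R) (g : T -> R) : bounded_measurable g ->
  exists2 s : R, (0 < s)%R & \int[mu]_x (expR (c * g x))%:E = s%:E.
Proof.
move=> [mg [M gM]].
have bnd x : (expR (- (`|c| * M)) <= expR (c * g x) <= expR (`|c| * M))%R.
  rewrite !ler_expR -ler_norml normrM.
  by apply: ler_wpM2l.
have me : measurable_fun setT (fun x => (expR (c * g x))%:E).
  apply/measurable_EFinP/measurableT_comp => //; exact: measurable_funM.
have cstE (k : R) : \int[mu]_x (cst k%:E) x = k%:E.
  by rewrite integral_cst// [X in _ * X]probability_setT mule1.
have lo : (expR (- (`|c| * M)))%:E <= \int[mu]_x (expR (c * g x))%:E.
  rewrite -cstE; apply: ge0_le_integral => //= x _.
  by rewrite lee_fin; case/andP: (bnd x).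
have hi : \int[mu]_x (expR (c * g x))%:E <= (expR (`|c| * M))%:E.
  rewrite -[leRHS]cstE; apply: ge0_le_integral => //= x _.
  by rewrite lee_fin; case/andP: (bnd x).
case: (integral _ _ _) lo hi => [s| |]//= lo _.
exists s => //; rewrite -lte_fin; apply: lt_le_trans lo.
by rewrite lte_fin expR_gt0.
Qed.

(** * Pointwise inequalities for the truncated likelihood ratio *)

Section likelihood_ratio.
Context {R : realType}.
Local Open Scope ring_scope.
Implicit Types (a c l u p q x y : R).

Lemma ler_npowR c x y : c <= 0 -> 0 < x -> x <= y -> y `^ c <= x `^ c.
Proof.
move=> c0 x0 xy; have y0 := lt_le_trans x0 xy.
rewrite -[c]opprK (powRN y) (powRN x) lef_pV2 ?posrE ?powR_gt0//.
by rewrite ge0_ler_powR ?nnegrE ?oppr_ge0 ?(ltW x0) ?(ltW y0).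
Qed.

(** With [ratio_powR_num], this says that [g = ln (q / p)] turns both integrands of the objective
    into h. At [p = 0] the right side vanishes because [0^(1-a) = 0]. *)
Lemma ratio_powR_den a p q : a != 0 -> a != 1 -> 0 <= p -> 0 <= q ->
  (q / p) `^ a * p = q `^ a * p `^ (1 - a).
Proof.
move=> a0 a1 p0 q0; have [->|pn0] := eqVneq p 0.
  by rewrite mulr0 powR0 ?mulr0// subr_eq0 eq_sym.
have p_gt0 : 0 < p by rewrite lt_def pn0.
rewrite powRM ?invr_ge0// -mulrA; congr (_ * _).
rewrite -powR_inv1// -powRrM mulN1r -[X in _ * X]powRr1// -powRD.
  by rewrite addrC.
by rewrite pn0 implybT.
Qed.

Lemma ratio_powR_num a p q : a != 0 -> a != 1 -> 0 <= p -> 0 <= q ->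
  (q / p) `^ (a - 1) * q = q `^ a * p `^ (1 - a).
Proof.
move=> a0 a1 p0 q0; have [->|qn0] := eqVneq q 0.
  by rewrite mulr0 powR0 ?mul0r.
have [->|pn0] := eqVneq p 0.
  by rewrite invr0 mulr0 !powR0 ?mul0r ?mulr0// subr_eq0// eq_sym.
rewrite powRM ?invr_ge0// mulrAC; congr (_ * _).
  rewrite -[X in _ * X]powRr1// -powRD ?qn0 ?implybT//.
  by rewrite subrK.
by rewrite -powR_inv1// -powRrM mulN1r opprB.
Qed.

(* Where p = 0 the likelihood ratio counts as +oo and truncates to u, whereas
   q / p would be 0. *)
Definition clamp_ratio l u p q : R :=
  if p == 0 then u else Num.max l (Num.min u (q / p)).

Lemma clamp_ratio_ge l u p q : l <= u -> l <= clamp_ratio l u p q.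
Proof.
by move=> lu; rewrite /clamp_ratio; case: ifPn => // _; rewrite le_max lexx.
Qed.

Lemma clamp_ratio_le l u p q : l <= u -> clamp_ratio l u p q <= u.
Proof.
move=> lu; rewrite /clamp_ratio; case: ifPn => // _.
by rewrite ge_max lu ge_min lexx.
Qed.

Lemma min_ratio_le_clamp l u p q :
  Num.min u (q / p) <= clamp_ratio l u p q.
Proof.
rewrite /clamp_ratio; case: ifPn => [/eqP ->|_].
  by rewrite invr0 mulr0 ge_min lexx.
by rewrite le_max lexx orbT.
Qed.

Lemma clamp_ratio_le_or l u p q : l <= u -> p != 0 ->
  clamp_ratio l u p q = l \/ clamp_ratio l u p q <= q / p.
Proof.
rewrite /clamp_ratio => lu /negbTE ->.
have [ml|lm] := leP (Num.min u (q / p)) l; [left|right] => //.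
by rewrite ge_min lexx orbT.
Qed.

Lemma clamp_ratio_ge_or l u p q : l <= u ->
  clamp_ratio l u p q = u \/ p != 0 /\ q / p <= clamp_ratio l u p q.
Proof.
rewrite /clamp_ratio => lu; case: ifPn => [_|p0]; first by left.
have [ur|ru] := leP u (q / p); first by left; apply/max_idPr.
by right; split => //; rewrite le_max lexx orbT.
Qed.

(** The truncation is either [u], giving the second summand, or at least [q / p]; the negative
    exponent [a - 1] then reverses the order and h is a bound. *)
Lemma clamp_ratio_num_le a l u p q : 0 < a < 1 -> 0 < l -> l <= u ->
    0 <= p -> 0 <= q ->
  clamp_ratio l u p q `^ (a - 1) * q <=
  q `^ a * p `^ (1 - a) + u `^ (a - 1) * q.
Proof.
move=> /andP[a0 a1] l0 lu p0 q0.
have h0 : 0 <= q `^ a * p `^ (1 - a) by rewrite mulr_ge0 ?powR_ge0.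
have u0 : 0 <= u `^ (a - 1) * q by rewrite mulr_ge0 ?powR_ge0.
case: (clamp_ratio_ge_or l u p q lu) => [->|[pn0 rw]]; first by rewrite lerDr.
have [->|qn0] := eqVneq q 0.
  by rewrite !mulr0 addr0 mulr_ge0 ?powR_ge0.
apply: (@le_trans _ _ (q `^ a * p `^ (1 - a))); last by rewrite lerDl.
rewrite -ratio_powR_num ?(gt_eqF a0) ?(lt_eqF a1)//.
rewrite ler_wpM2r// ler_npowR//.
  by rewrite subr_le0 ltW.
by rewrite divr_gt0// lt_def ?pn0 ?qn0.
Qed.

(** Dually, the truncation is either [l] or at most [q / p], and the exponent [a] is positive. *)
Lemma clamp_ratio_den_le a l u p q : 0 < a < 1 -> 0 < l -> l <= u ->
    0 <= p -> 0 <= q ->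
  clamp_ratio l u p q `^ a * p <= q `^ a * p `^ (1 - a) + l `^ a * p.
Proof.
move=> /andP[a0 a1] l0 lu p0 q0.
have h0 : 0 <= q `^ a * p `^ (1 - a) by rewrite mulr_ge0 ?powR_ge0.
have l0' : 0 <= l `^ a * p by rewrite mulr_ge0 ?powR_ge0.
have [pE|pn0] := eqVneq p 0; first by move: h0; rewrite pE !mulr0 addr0.
case: (clamp_ratio_le_or l u p q lu pn0) => [->|wr]; first by rewrite lerDr.
apply: (@le_trans _ _ (q `^ a * p `^ (1 - a))); last by rewrite lerDl.
rewrite -ratio_powR_den ?(gt_eqF a0) ?(lt_eqF a1)// ler_wpM2r//.
have w0 : 0 <= clamp_ratio l u p q.
  by apply: (le_trans (ltW l0)); exact: clamp_ratio_ge.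
by rewrite ge0_ler_powR ?nnegrE ?(ltW a0) ?divr_ge0.
Qed.

(** Write w for the truncation. Where [w <= q / p], [w^a p = w^(a-1) (w p) <= w^(a-1) q]; elsewhere
    [w = l]. *)
Lemma clamp_ratio_den_le_num a l u p q : 0 < a -> 0 < l -> l <= u ->
    0 <= p -> 0 <= q ->
  clamp_ratio l u p q `^ a * p <=
  clamp_ratio l u p q `^ (a - 1) * q + l `^ a * p.
Proof.
move=> a0 l0 lu p0 q0.
have h0 : 0 <= clamp_ratio l u p q `^ (a - 1) * q by rewrite mulr_ge0 ?powR_ge0.
have l0' : 0 <= l `^ a * p by rewrite mulr_ge0 ?powR_ge0.
have [pE|pn0] := eqVneq p 0.
  by move: h0; rewrite pE !mulr0 addr0.
case: (clamp_ratio_le_or l u p q lu pn0) => [->|wr].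
  by rewrite lerDr mulr_ge0 ?powR_ge0.
apply: (@le_trans _ _ (clamp_ratio l u p q `^ (a - 1) * q)); last first.
  by rewrite lerDl.
have w0 : 0 < clamp_ratio l u p q.
  by apply: (lt_le_trans l0); exact: clamp_ratio_ge.
rewrite -(mulr_powRB1 (ltW w0) a0) mulrAC mulrC ler_wpM2l ?powR_ge0//.
by rewrite -ler_pdivlMr// lt_def pn0.
Qed.

End likelihood_ratio.

(** * The logarithm of the truncated ratio as a test function *)

Section truncated_log_ratio.
Context {d} {T : measurableType d} {R : realType} {p q : T -> R}.
Hypotheses (mp : measurable_fun setT p) (mq : measurable_fun setT q).
Hypotheses (p0 : forall x, (0 <= p x)%R) (q0 : forall x, (0 <= q x)%R).

Lemma measurable_ratio : measurable_fun setT (fun x => q x / p x)%R.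
Proof.
under eq_fun do rewrite -powR_inv1//.
apply: measurable_funM => //.
exact: (measurableT_comp (measurable_powR _)).
Qed.

Lemma measurable_clamp_ratio l u :
  measurable_fun setT (fun x => clamp_ratio l u (p x) (q x)).
Proof.
apply: measurable_fun_ifT => //; first exact: measurable_fun_eqr.
apply: measurable_maxr => //; apply: measurable_minr => //.
exact: measurable_ratio.
Qed.

Lemma bounded_measurable_ln_clamp l u : (0 < l)%R -> (l <= u)%R ->
  bounded_measurable (fun x => ln (clamp_ratio l u (p x) (q x))).
Proof.
move=> l0 lu; split.
  by apply: measurableT_comp => //; exact: measurable_clamp_ratio.
exists (Num.max `|ln l| `|ln u|)%R => x.
have wl := clamp_ratio_ge l u (p x) (q x) lu.
have wu := clamp_ratio_le l u (p x) (q x) lu.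
have w0 := lt_le_trans l0 wl.
have lw : (ln l <= ln (clamp_ratio l u (p x) (q x)))%R.
  by rewrite ler_ln ?posrE.
have uw : (ln (clamp_ratio l u (p x) (q x)) <= ln u)%R.
  by rewrite ler_ln ?posrE// (lt_le_trans l0).
rewrite ler_norml; apply/andP; split.
  rewrite lerNl le_max -[X in (_ <= X)%R]normrN.
  by rewrite (le_trans _ (ler_norm _)) ?lerN2.
by rewrite le_max (le_trans uw (ler_norm _)) orbT.
Qed.

Lemma expR_ln_clamp_ratio l u c x : (0 < l)%R -> (l <= u)%R ->
  (expR (c * ln (clamp_ratio l u (p x) (q x))) =
   clamp_ratio l u (p x) (q x) `^ c)%R.
Proof.
move=> l0 lu; rewrite /powR gt_eqF//.
by apply: (lt_le_trans l0); exact: clamp_ratio_ge.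
Qed.

End truncated_log_ratio.

(** * Finiteness and symmetry of the variational problem *)

Lemma renyi_obj_fin {d} {T : measurableType d} {R : realType}
    (P Q : probability T R) (a : R) (g : T -> R) : bounded_measurable g ->
  exists s w : R, [/\ (0 < s)%R, (0 < w)%R,
    \int[Q]_x (expR ((a - 1) * g x))%:E = s%:E,
    \int[P]_x (expR (a * g x))%:E = w%:E &
    renyi_obj P Q a g = ((a - 1)^-1 * ln s - a^-1 * ln w)%:E].
Proof.
move=> bg.
have [s s0 sE] := integral_expR_bounded Q (a - 1) g bg.
have [w w0 wE] := integral_expR_bounded P a g bg.
by exists s, w; split => //; rewrite /renyi_obj sE wE !lne_EFin.
Qed.

Definition renyi_sup {d} {T : measurableType d} {R : realType}
    (P Q : set T -> \bar R) (a : R) : \bar R :=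
  ereal_sup [set renyi_obj P Q a g |
    g in [set g : T -> R | bounded_measurable g]].

Lemma renyi_obj_le_sup {d} {T : measurableType d} {R : realType}
    (P Q : set T -> \bar R) (a : R) (g : T -> R) : bounded_measurable g ->
  renyi_obj P Q a g <= renyi_sup P Q a.
Proof. by move=> bg; apply: ereal_sup_ubound; exists g. Qed.

(** Replacing [(a, g)] by [(1 - a, -g)] exchanges the exponents [(a - 1) g] and [a g], and exchanges
    the prefactors [1/(a-1)] and [-1/a]; negation is an involution on bounded measurable
    functions. *)
Lemma renyi_sup_swap {d} {T : measurableType d} {R : realType}
    (P Q : probability T R) (a : R) :
  renyi_sup P Q a = renyi_sup Q P (1 - a)%R.
Proof.
have bN (g : T -> R) : bounded_measurable g -> bounded_measurable (\- g)%R.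
  move=> [mg [M gM]]; split; first exact: measurable_funN.
  by exists M => x /=; rewrite normrN.
have objN (g : T -> R) : bounded_measurable g ->
    renyi_obj P Q a g = renyi_obj Q P (1 - a)%R (\- g)%R.
  move=> bg; have [s [w [s0 w0 sE wE ->]]] := renyi_obj_fin P Q a g bg.
  rewrite /renyi_obj.
  under [X in _ = _ * lne X - _]eq_integral do
    rewrite /= addrAC subrr add0r mulrNN.
  under [X in _ = _ - _ * lne X]eq_integral do rewrite /= -mulrNN opprK opprB.
  rewrite wE sE !lne_EFin// -!EFinM -EFinB; congr EFin.
  rewrite addrAC subrr add0r invrN -[(1 - a)%R]opprB invrN.
  by rewrite !mulNr opprK addrC.
congr (ereal_sup _); apply/seteqP; split => _ [g /= bg <-].
  by exists (\- g)%R; [exact: bN|rewrite -objN].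
exists (\- g)%R; first exact: bN.
rewrite objN//; last exact: bN.
by congr renyi_obj; apply/funext => x /=; rewrite opprK.
Qed.

(** * Integrals over [P] and [Q] in terms of densities *)

Section densities.
Context {d} {T : measurableType d} {R : realType} {P Q : probability T R}.
Context {nu : {sigma_finite_measure set T -> \bar R}} {p q : T -> R}.
Hypotheses (mp : measurable_fun setT p) (mq : measurable_fun setT q).
Hypotheses (p0 : forall x, (0 <= p x)%R) (q0 : forall x, (0 <= q x)%R).
Hypothesis hP : forall A, measurable A -> P A = \int[nu]_(x in A) (p x)%:E.
Hypothesis hQ : forall A, measurable A -> Q A = \int[nu]_(x in A) (q x)%:E.
Variable a : R.
Hypotheses (a_neq0 : a != 0%R) (a_neq1 : a != 1%R).

Local Notation I := (renyi_int nu p q a).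
Local Notation K := ((a * (a - 1))^-1)%R.

Let mpowR (f : T -> R) c : measurable_fun setT f ->
  measurable_fun setT (fun x => f x `^ c)%R.
Proof. by move=> mf; exact: (measurableT_comp (measurable_powR c)). Qed.

Let mexpR c (g : T -> R) : bounded_measurable g ->
  measurable_fun setT (fun x => expR (c * g x)).
Proof.
by move=> [mg _]; apply: measurableT_comp => //; exact: measurable_funM.
Qed.

Let mh : measurable_fun setT (fun x => q x `^ a * p x `^ (1 - a))%R.
Proof. by apply: measurable_funM; exact: mpowR. Qed.

Let h0 x : (0 <= q x `^ a * p x `^ (1 - a))%R.
Proof. by rewrite mulr_ge0 ?powR_ge0. Qed.

(* The integrand vanishes where p = 0, because 0 `^ (1 - a) = 0. *)
Lemma renyi_intE : I = \int[nu]_x (q x `^ a * p x `^ (1 - a))%:E.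
Proof.
rewrite /renyi_int integral_mkcond; apply: eq_integral => x _.
rewrite patchE; case: ifPn => //; rewrite notin_setE/= => /negP.
rewrite -leNgt => px; have -> : p x = 0%R by apply/eqP; rewrite eq_le px p0.
by rewrite powR0 ?mulr0// subr_eq0 eq_sym.
Qed.

Lemma renyi_int_ge0 : 0 <= I.
Proof. by rewrite renyi_intE integral_ge0// => x _; rewrite lee_fin h0. Qed.

Let integralQ (f : T -> R) : (forall x, 0 <= f x)%R -> measurable_fun setT f ->
  \int[Q]_x (f x)%:E = \int[nu]_x (f x * q x)%:E.
Proof. by move=> f0 mf; exact: (integral_density Q nu q mq q0 hQ). Qed.

Let integralP (f : T -> R) : (forall x, 0 <= f x)%R -> measurable_fun setT f ->
  \int[P]_x (f x)%:E = \int[nu]_x (f x * p x)%:E.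
Proof. by move=> f0 mf; exact: (integral_density P nu p mp p0 hP). Qed.

Let int_q : \int[nu]_x (q x)%:E = 1.
Proof. by rewrite -hQ// [LHS]probability_setT. Qed.

Let int_p : \int[nu]_x (p x)%:E = 1.
Proof. by rewrite -hP// [LHS]probability_setT. Qed.

(** Displays the objective as [K] times the logarithm of [s^a w^(1-a)], the quantity that Hoelder's
    inequality compares with [I]. *)
Lemma objective_split (s w : R) :
  ((a - 1)^-1 * ln s - a^-1 * ln w = K * (a * ln s + (1 - a) * ln w))%R.
Proof. by field; rewrite a_neq0 subr_eq0 a_neq1. Qed.

(** * Upper bounds by Hoelder's inequality *)

Lemma renyi_obj_le_lt1 g : (0 < a < 1)%R -> bounded_measurable g ->
  renyi_obj P Q a g <= K%:E * lne I.
Proof.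
move=> a01 bg; have /andP[a0 a1] := a01.
have [s [w [s0 w0 sE wE ->]]] := renyi_obj_fin P Q a g bg.
have K0 : (K < 0)%R by rewrite invr_lt0 pmulr_rlt0// subr_lt0.
rewrite leNgt nmul_lne_lt ?renyi_int_ge0// -leNgt.
have Is : I <= (s `^ a * w `^ (1 - a))%:E.
  rewrite renyi_intE.
  (* The exponentials cancel, since [a (a - 1) g + (1 - a) a g = 0]. *)
  rewrite (eq_integral (fun x => ((expR ((a - 1) * g x) * q x) `^ a *
      (expR (a * g x) * p x) `^ (1 - a))%R%:E)); last first.
    move=> x _; rewrite !powRM ?expR_ge0// -!expRM mulrACA -expRD.
    rewrite (_ : (_ * g x * a + _ = 0)%R); last by ring.
    by rewrite expR0 mul1r.
  apply: weighted_hoelder => //.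
  - by apply: measurable_funM => //; exact: mexpR.
  - by apply: measurable_funM => //; exact: mexpR.
  - by move=> x; rewrite mulr_ge0 ?expR_ge0.
  - by move=> x; rewrite mulr_ge0 ?expR_ge0.
  - by rewrite -integralQ ?sE//; exact: mexpR.
  - by rewrite -integralP ?wE//; exact: mexpR.
apply: (le_trans Is); rewrite lee_fin objective_split.
by rewrite [(K * _)%R]mulrC mulfK ?lt_eqF// expRD !(mulrC _ (ln _)) !expRM !lnK ?posrE.
Qed.

(** By contradiction: failure of the bound means [I < s^a w^(1-a)], so [I] is finite and Hoelder's
    inequality with [t = 1/a] can be applied. *)
Lemma renyi_obj_le_gt1 g : (1 < a)%R -> Q `<< P -> bounded_measurable g ->
  renyi_obj P Q a g <= K%:E * lne I.
Proof.
move=> a1 /null_content_dominatesP QP bg.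
have a0 : (0 < a)%R by exact: lt_trans a1.
have [s [w [s0 w0 sE wE ->]]] := renyi_obj_fin P Q a g bg.
have K0 : (0 < K)%R by rewrite invr_gt0 mulr_gt0// subr_gt0.
rewrite leNgt pmul_lne_lt ?renyi_int_ge0//; apply/negP.
rewrite objective_split [(K * _)%R]mulrC mulfK ?gt_eqF// => Ilt.
have Ifin : I \is a fin_num.
  by rewrite ge0_fin_numE ?renyi_int_ge0// (lt_trans Ilt)// ltry.
move: Ilt; rewrite -(fineK Ifin) lte_fin; set i := fine I.
set v := expR _ => iv.
have i0 : (0 <= i)%R by rewrite fine_ge0// renyi_int_ge0.
(* [i] may be 0, while [weighted_hoelder] takes positive bounds; the midpoint is positive and still
   below [v]. *)
pose v' := ((i + v) / 2)%R.
have v'v : (v' < v)%R by rewrite /v'; lra.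
have iv' : (i < v')%R by rewrite /v'; lra.
have v'0 : (0 < v')%R by exact: le_lt_trans iv'.
have ainv01 : (0 < a^-1 < 1)%R by rewrite invr_gt0 a0 invf_lt1.
have sv' : (s <= v' `^ a^-1 * w `^ (1 - a^-1))%R.
  rewrite -lee_fin -sE.
  (* Absolute continuity enters here: [N] is [P]-null, hence [Q]-null, and may be removed from the
     integral over [Q]. *)
  pose N := [set x | p x == 0%R].
  have mN : measurable N.
    rewrite (_ : N = setT `&` p @^-1` [set 0%R]); first exact: mp.
    by rewrite setTI; apply/seteqP; split => x /= /eqP.
  have PN : P N = 0.
    by rewrite hP// integral0_eq// => x /eqP ->.
  rewrite (ge0_negligible_integral mN)//; last 2 first.
  - by apply/measurable_EFinP; exact: mexpR.
  - exact: QP.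
  rewrite setTD (integral_density Q nu q mq q0 hQ)//; last 2 first.
  - exact: measurableC.
  - exact: mexpR.
  have := @weighted_hoelder R d T nu a^-1%R v' w
    (fun x => q x `^ a * p x `^ (1 - a))%R (fun x => expR (a * g x) * p x)%R.
  have mV : measurable_fun setT (fun x => expR (a * g x) * p x)%R.
    by apply: measurable_funM => //; exact: mexpR.
  have V0 x : (0 <= expR (a * g x) * p x)%R by rewrite mulr_ge0 ?expR_ge0.
  have mHV : measurable_fun setT (fun x => ((q x `^ a * p x `^ (1 - a)) `^ a^-1 *
      (expR (a * g x) * p x) `^ (1 - a^-1))%R%:E).
    by apply/measurable_EFinP; apply: measurable_funM; exact: mpowR.
  have HV0 x : (0 <= (q x `^ a * p x `^ (1 - a)) `^ a^-1 *
      (expR (a * g x) * p x) `^ (1 - a^-1))%R.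
    by rewrite mulr_ge0 ?powR_ge0.
  move=> /(_ ainv01 mh mV h0 V0 v'0 w0) hoe.
  apply: (le_trans _ (hoe _ _)); last 2 first.
  - by rewrite -renyi_intE -(fineK Ifin) lee_fin ltW.
  - by rewrite -integralP ?wE//; exact: mexpR.
  apply: le_trans; last first.
    apply: (ge0_subset_integral nu (measurableC mN) measurableT mHV) => //.
    by move=> x _; rewrite lee_fin.
  apply: ge0_le_integral => //.
  - exact: measurableC.
  - by move=> x _; rewrite lee_fin mulr_ge0 ?expR_ge0.
  - apply/measurable_EFinP/measurable_funTS.
    by apply: measurable_funM => //; exact: mexpR.
  - exact: measurable_funTS mHV.
  - move=> x /= /negP px; rewrite lee_fin le_eqVlt; apply/orP; left; apply/eqP.
    (* Off [N] the powers of [p x] cancel, as [(1 - a)/a + 1 - 1/a = 0], and the exponential has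
       exponent [a (1 - 1/a) g = (a - 1) g]. *)
    rewrite !powRM ?powR_ge0 ?expR_ge0// -!powRrM -expRM mulfV//.
    rewrite powRr1// [RHS]mulrACA -powRD ?px ?implybT//.
    rewrite (_ : (_ / _ + _ = 0)%R); last by field.
    by rewrite powRr0 mulr1 mulrC; congr (_ * expR _)%R; field.
move: sv'; rewrite -ler_ln ?posrE ?mulr_gt0 ?powR_gt0//.
rewrite lnM ?posrE ?powR_gt0// !ln_powR.
have : (ln v' < a * ln s + (1 - a) * ln w)%R.
  by rewrite -[ltRHS]expRK ltr_ln ?posrE ?expR_gt0.
rewrite -(ltr_pM2l (_ : 0 < a^-1)%R) ?invr_gt0// mulrDr !mulrA mulVf// mul1r.
rewrite mulrBr mulr1 mulVf// => h1 h2; lra.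
Qed.

(** * Lower bounds by truncated log-likelihood ratios *)

Let integral_addM (H f : T -> R) (k : R) : measurable_fun setT H ->
    (forall x, 0 <= H x)%R -> measurable_fun setT f -> (forall x, 0 <= f x)%R ->
    \int[nu]_x (f x)%:E = 1 -> (0 <= k)%R ->
  \int[nu]_x (H x + k * f x)%:E = \int[nu]_x (H x)%:E + k%:E.
Proof.
move=> mH H0 mf f0 f1 k0; under eq_integral do rewrite EFinD.
rewrite ge0_integralD//=; last 4 first.
- by move=> x _; rewrite lee_fin.
- exact/measurable_EFinP.
- by move=> x _; rewrite lee_fin mulr_ge0.
- by apply/measurable_EFinP; exact: measurable_funM.
under [X in _ + X]eq_integral do rewrite EFinM.
rewrite ge0_integralZl//=; last 2 first.
- exact/measurable_EFinP.
- by move=> x _; rewrite lee_fin.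
by rewrite f1 mule1.
Qed.

(** As [K < 0], a real [r] below the target means [I < v] with [v = expR (r / K)]. The truncation is
    made fine enough that its error fits in [v - I], so both integrals are at most [v]. *)
Lemma renyi_le_sup_lt1 : (0 < a < 1)%R ->
  K%:E * lne I <= renyi_sup P Q a.
Proof.
move=> a01; have /andP[a0 a1] := a01.
have K0 : (K < 0)%R by rewrite invr_lt0 pmulr_rlt0// subr_lt0.
apply: le_lt_EFin => r; rewrite lt_nmul_lne ?renyi_int_ge0//.
set v := expR _ => Iv.
have Ifin : I \is a fin_num.
  by rewrite ge0_fin_numE ?renyi_int_ge0// (lt_trans Iv)// ltry.
move: Iv; rewrite -(fineK Ifin) lte_fin -subr_gt0.
set i := fine I; set e := (v - i)%R => e0.
(* Chosen so that [l^a] and [u^(a-1)] are at most [e]; comparing with 1 ensures [l <= u]. *)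
pose l := Num.min 1%R (e `^ a^-1)%R; pose u := Num.max 1%R (e `^ (a - 1)^-1)%R.
have l0 : (0 < l)%R by rewrite lt_min ltr01 powR_gt0.
have lu : (l <= u)%R.
  by rewrite (@le_trans _ _ 1%R)// /l /u ?ge_min ?le_max lexx.
have la : (l `^ a <= e)%R.
  rewrite -[leRHS]powRr1 ?(ltW e0)// -(mulVf a_neq0) powRrM.
  by rewrite ge0_ler_powR ?nnegrE ?powR_ge0 ?(ltW a0) ?(ltW l0)// /l ge_min lexx orbT.
have ua : (u `^ (a - 1) <= e)%R.
  have eE : e = ((e `^ (a - 1)^-1) `^ (a - 1))%R.
    by rewrite -powRrM mulVf ?subr_eq0// powRr1// ltW.
  rewrite [leRHS]eE.
  by rewrite ler_npowR ?powR_gt0// ?subr_le0 ?(ltW a1)// /u le_max lexx orbT.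
have bg := bounded_measurable_ln_clamp mp mq p0 l u l0 lu.
have mw := measurable_clamp_ratio mp mq p0 l u.
have [s [w [s0 w0 sE wE oE]]] := renyi_obj_fin P Q a _ bg.
have sv : (s <= v)%R.
  rewrite -lee_fin -sE.
  under eq_integral do rewrite expR_ln_clamp_ratio//.
  rewrite integralQ; [|by move=> x; rewrite powR_ge0|exact: mpowR].
  apply: (@le_trans _ _
      (\int[nu]_x (q x `^ a * p x `^ (1 - a) + u `^ (a - 1) * q x)%:E)).
    apply: ge0_le_integral => //.
    - by move=> x _; rewrite lee_fin mulr_ge0 ?powR_ge0.
    - by apply/measurable_EFinP/measurable_funM => //; exact: mpowR.
    - apply/measurable_EFinP/measurable_funD => //.
      exact: measurable_funM.
    - by move=> x _; rewrite lee_fin clamp_ratio_num_le.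
  rewrite integral_addM ?powR_ge0// -renyi_intE -(fineK Ifin) -EFinD lee_fin.
  by rewrite -lerBrDl.
have wv : (w <= v)%R.
  rewrite -lee_fin -wE.
  under eq_integral do rewrite expR_ln_clamp_ratio//.
  rewrite integralP; [|by move=> x; rewrite powR_ge0|exact: mpowR].
  apply: (@le_trans _ _
      (\int[nu]_x (q x `^ a * p x `^ (1 - a) + l `^ a * p x)%:E)).
    apply: ge0_le_integral => //.
    - by move=> x _; rewrite lee_fin mulr_ge0 ?powR_ge0.
    - by apply/measurable_EFinP/measurable_funM => //; exact: mpowR.
    - apply/measurable_EFinP/measurable_funD => //.
      exact: measurable_funM.
    - by move=> x _; rewrite lee_fin clamp_ratio_den_le.
  rewrite integral_addM ?powR_ge0// -renyi_intE -(fineK Ifin) -EFinD lee_fin.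
  by rewrite -lerBrDl.
apply: (le_trans _ (renyi_obj_le_sup P Q a _ bg)).
rewrite oE lee_fin objective_split.
(* The convex combination of [ln s] and [ln w] is at most [ln v = r / K], and multiplying by [K < 0]
   reverses this. *)
have -> : r = (K * (r / K))%R by rewrite mulrC divfK// lt_eqF.
rewrite ler_nM2l// -[leRHS]expRK -/v.
have ls : (ln s <= ln v)%R by rewrite ler_ln ?posrE ?expR_gt0.
have lw : (ln w <= ln v)%R by rewrite ler_ln ?posrE ?expR_gt0.
nra.
Qed.

(** Monotone convergence, contraposed: if every truncated integral were at most [c], so would be
    their limit [I]. *)
Lemma renyi_int_truncate (c : R) : (1 < a)%R -> c%:E < I ->
  exists n : nat,
    c%:E < \int[nu]_x (Num.min n.+1%:R (q x / p x) `^ (a - 1) * q x)%:E.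
Proof.
move=> a1; apply: contraPP => /forallNP h; apply/negP; rewrite -leNgt.
pose G n x := (Num.min n.+1%:R (q x / p x) `^ (a - 1) * q x)%:E.
have m0 n x : (0 <= Num.min n.+1%:R (q x / p x))%R.
  by rewrite le_min ler0n divr_ge0.
have mG n : measurable_fun setT (G n).
  apply/measurable_EFinP/measurable_funM => //; apply: mpowR.
  by apply: measurable_minr => //; exact: measurable_ratio.
have G0 n x : setT x -> 0 <= G n x.
  by move=> _; rewrite lee_fin mulr_ge0 ?powR_ge0.
have ndG x : setT x -> {homo G^~ x : n m / (n <= m)%N >-> n <= m}.
  move=> _ n m nm; rewrite lee_fin ler_wpM2r// ge0_ler_powR ?nnegrE//.
    by rewrite subr_ge0 ltW.
  rewrite le_min [in X in _ && X]ge_min lexx orbT andbT.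
  by rewrite ge_min ler_nat ltnS nm.
rewrite renyi_intE (eq_integral (fun x => limn (G^~ x))); last first.
  (* The sequence is constant once [n] reaches the integer part of [q x / p x]. *)
  move=> x _; apply/esym/lim_near_cst => //.
  exists (Num.truncn (q x / p x)) => // n /= xn.
  rewrite /G min_r ?ratio_powR_num//.
  by rewrite (le_trans (ltW (truncnS_gt _)))// ler_nat ltnS.
rewrite monotone_convergence//; apply: lime_le.
  apply: ereal_nondecreasing_is_cvgn => n m nm.
  by apply: ge0_le_integral => //= x _; [exact: G0|exact: ndG].
by apply: nearW => n; rewrite leNgt; apply/negP; exact: h.
Qed.

Lemma renyi_le_sup_gt1 : (1 < a)%R -> K%:E * lne I <= renyi_sup P Q a.
Proof.
move=> a1; have a0 : (0 < a)%R by exact: lt_trans a1.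
have K0 : (0 < K)%R by rewrite invr_gt0 mulr_gt0// subr_gt0.
apply: le_lt_EFin => r; rewrite lt_pmul_lne ?renyi_int_ge0//.
set c := expR _ => /(renyi_int_truncate _ a1)[n cn].
have c0 : (0 < c)%R by exact: expR_gt0.
apply/lee_addgt0Pr => e e0.
(* With [c < s], [l^a <= e a c] gives [ln w <= ln s + ln (1 + l^a / s) <= ln s + e a], so the term
   [ln w / a] costs at most [e]. *)
pose l := Num.min 1%R ((e * a * c) `^ a^-1)%R; pose u : R := n.+1%:R.
have eac0 : (0 < e * a * c)%R by rewrite !mulr_gt0.
have l0 : (0 < l)%R by rewrite lt_min ltr01 powR_gt0.
have lu : (l <= u)%R by rewrite (@le_trans _ _ 1%R)// /l /u ?ge_min ?lexx ?ler1n.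
have la : (l `^ a <= e * a * c)%R.
  rewrite -[leRHS]powRr1 ?(ltW eac0)// -(mulVf a_neq0) powRrM.
  by rewrite ge0_ler_powR ?nnegrE ?powR_ge0 ?(ltW a0) ?(ltW l0)// /l ge_min lexx orbT.
have bg := bounded_measurable_ln_clamp mp mq p0 l u l0 lu.
have mw := measurable_clamp_ratio mp mq p0 l u.
have [s [w [s0 w0 sE wE oE]]] := renyi_obj_fin P Q a _ bg.
have sE' : \int[nu]_x (clamp_ratio l u (p x) (q x) `^ (a - 1) * q x)%:E = s%:E.
  rewrite -sE; under [RHS]eq_integral do rewrite expR_ln_clamp_ratio//.
  by rewrite integralQ//; [move=> x; rewrite powR_ge0|exact: mpowR].
have mwq : measurable_fun setT
    (fun x => clamp_ratio l u (p x) (q x) `^ (a - 1) * q x)%R.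
  by apply: measurable_funM => //; exact: mpowR.
have wq0 x : (0 <= clamp_ratio l u (p x) (q x) `^ (a - 1) * q x)%R.
  by rewrite mulr_ge0 ?powR_ge0.
have cs : (c < s)%R.
  rewrite -lte_fin -sE'; apply: (lt_le_trans cn).
  apply: ge0_le_integral => //.
  - by move=> x _; rewrite lee_fin mulr_ge0 ?powR_ge0.
  - apply/measurable_EFinP/measurable_funM => //; apply: mpowR.
    by apply: measurable_minr => //; exact: measurable_ratio.
  - exact/measurable_EFinP.
  - move=> x _; rewrite lee_fin ler_wpM2r// ge0_ler_powR ?nnegrE//.
    + by rewrite subr_ge0 ltW.
    + by rewrite le_min ler0n divr_ge0.
    + by rewrite (le_trans (ltW l0))// clamp_ratio_ge.
    + exact: min_ratio_le_clamp.
have ws : (w <= s + l `^ a)%R.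
  rewrite -lee_fin -wE EFinD -sE' -(integral_addM _ p) ?powR_ge0//.
  under eq_integral do rewrite expR_ln_clamp_ratio//.
  rewrite integralP; [|by move=> x; rewrite powR_ge0|exact: mpowR].
  apply: ge0_le_integral => //.
  - by move=> x _; rewrite lee_fin mulr_ge0 ?powR_ge0.
  - by apply/measurable_EFinP/measurable_funM => //; exact: mpowR.
  - apply/measurable_EFinP/measurable_funD => //.
    exact: measurable_funM.
  - by move=> x _; rewrite lee_fin clamp_ratio_den_le_num.
apply: (le_trans _ (leeD2r _ (renyi_obj_le_sup P Q a _ bg))).
rewrite oE -EFinD lee_fin.
have lw : (ln w <= ln s + e * a)%R.
  apply: (@le_trans _ _ (ln (s * (1 + l `^ a / s)))%R).
    rewrite mulrDr mulr1 mulrC divfK ?gt_eqF// ler_ln ?posrE//.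
    by rewrite addr_gt0// powR_gt0.
  have ls0 : (0 < l `^ a / s)%R by rewrite divr_gt0// powR_gt0.
  rewrite lnM ?posrE ?addr_gt0// lerD2l.
  rewrite (le_trans (le_ln1Dx _)) ?(lt_trans _ ls0) ?ltrN10//.
  by rewrite ler_pdivrMr// (le_trans la)// ler_wpM2l// ?mulr_ge0 ?ltW.
have -> : r = (K * ln c)%R by rewrite expRK mulrC divfK// gt_eqF.
have lc : (K * ln c <= K * ln s)%R by rewrite ler_pM2l// ler_ln ?posrE// ltW.
apply: (le_trans lc).
have lw' : (a^-1 * ln w <= a^-1 * ln s + e)%R.
  by rewrite ler_pdivrMl// mulrDr mulrA mulfV// mul1r [(a * e)%R]mulrC.
have -> : K = ((a - 1)^-1 - a^-1)%R by field; rewrite a_neq0 subr_eq0 a_neq1.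
by rewrite mulrBl; lra.
Qed.

Lemma renyi_sup_not_dominated : (1 < a)%R -> ~ Q `<< P ->
  renyi_sup P Q a = +oo.
Proof.
move=> a1 nQP.
have [N [mN PN QN]] : exists N, [/\ measurable N, P N = 0 & Q N <> 0].
  apply: contrapT => /forallNP h; apply: nQP.
  apply/null_content_dominatesP => N mN PN.
  by apply: contrapT => QN; exact: (h N).
have [b b0 QNE] : exists2 b, (0 < b)%R & Q N = b%:E.
  have QNfin : Q N \is a fin_num by exact: fin_num_measure.
  exists (fine (Q N)); last by rewrite fineK.
  rewrite lt_def fine_ge0 ?measure_ge0// andbT.
  by rewrite fine_eq0//; apply/eqP.
apply/eqP; rewrite -leye_eq; apply: le_lt_EFin => r _.
(* The [P]-integral is 1 and the [Q]-integral at least [e^((a-1)t) b], so the objective is at least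
   [t + ln b / (a - 1)]; [t] makes this equal to [r]. *)
pose t := (r - (a - 1)^-1 * ln b)%R; pose g x : R := (t * \1_N x)%R.
have bg : bounded_measurable g.
  split; first by apply: measurable_funM => //; exact: measurable_indic.
  exists `|t|%R => x; rewrite /g normrM indicE.
  by case: (x \in N); rewrite ?normr1 ?normr0 ?mulr1 ?mulr0.
have [s [w [s0 w0 sE wE oE]]] := renyi_obj_fin P Q a _ bg.
have ws : w = 1%R.
  apply: EFin_inj; rewrite -wE (ge0_negligible_integral mN)//; last first.
    by apply/measurable_EFinP; exact: mexpR.
  rewrite (eq_integral (cst 1)); last first.
    move=> x; rewrite inE => -[_ Nx].
    by rewrite /g indicE memNset// mulr0 mulr0 expR0.
  rewrite integral_cst ?mul1e ?setTD; last exact: measurableC.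
  by rewrite [LHS]probability_setC// PN sube0.
have bs : (expR ((a - 1) * t) * b <= s)%R.
  rewrite -lee_fin -sE.
  apply: le_trans; last first.
    apply: (ge0_subset_integral Q mN measurableT) => //.
    by apply/measurable_EFinP; exact: mexpR.
  rewrite (eq_integral (cst (expR ((a - 1) * t))%:E)); last first.
    by move=> x Nx; rewrite /g indicE Nx mulr1.
  by rewrite integral_cst// [X in _ * X]QNE.
apply: (le_trans _ (renyi_obj_le_sup P Q a _ bg)).
rewrite oE ws ln1 mulr0 subr0 lee_fin.
rewrite ler_pdivlMl ?subr_gt0//.
apply: (@le_trans _ _ (ln (expR ((a - 1) * t) * b))%R); last first.
  by rewrite ler_ln ?posrE ?mulr_gt0 ?expR_gt0.
rewrite lnM ?posrE ?expR_gt0// expRK /t mulrBr mulrA mulfV ?subr_eq0//.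
by rewrite mul1r subrK.
Qed.

End densities.

(** * Assembling the three ranges of [a] *)

Lemma renyi_eq_sup_gt1 {d} {T : measurableType d} {R : realType}
    (P Q : probability T R) (nu : {sigma_finite_measure set T -> \bar R})
    (p q : T -> R) (a : R) :
    measurable_fun setT p -> measurable_fun setT q ->
    (forall x, 0 <= p x)%R -> (forall x, 0 <= q x)%R ->
    (forall A, measurable A -> P A = \int[nu]_(x in A) (p x)%:E) ->
    (forall A, measurable A -> Q A = \int[nu]_(x in A) (q x)%:E) ->
    (1 < a)%R ->
  (if pselect (Q `<< P) then
     ((a * (a - 1))^-1)%:E * lne (renyi_int nu p q a) else +oo) =
  renyi_sup P Q a.
Proof.
move=> mp mq p0 q0 hP hQ a1.
have a_neq0 : a != 0%R by rewrite gt_eqF// (lt_trans _ a1).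
have a_neq1 : a != 1%R by rewrite gt_eqF.
case: pselect => [QP|nQP]; last by rewrite renyi_sup_not_dominated.
apply/eqP; rewrite eq_le; apply/andP; split.
  exact: renyi_le_sup_gt1.
by apply: ge_ereal_sup => _ [g bg <-]; exact: renyi_obj_le_gt1.
Qed.

Theorem mainTheorem9 (d : measure_display) (T : measurableType d) (R : realType)
  (P Q : probability T R) (nu : {sigma_finite_measure set T -> \bar R})
  (p q : T -> R)
  (p_meas : measurable_fun setT p) (q_meas : measurable_fun setT q)
  (p_ge0 : forall x, (0 <= p x)%R) (q_ge0 : forall x, (0 <= q x)%R)
  (hP : forall A, measurable A -> P A = \int[nu]_(x in A) (p x)%:E)
  (hQ : forall A, measurable A -> Q A = \int[nu]_(x in A) (q x)%:E)
  (a : R) (ha0 : a != 0%R) (ha1 : a != 1%R) :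
  renyi nu P Q p q a =
  ereal_sup [set renyi_obj P Q a g | g in [set g : T -> R | bounded_measurable g]].
Proof.
rewrite -/(renyi_sup P Q a) /renyi; case: ifPn => [a01|].
  apply/eqP; rewrite eq_le; apply/andP; split.
    exact: renyi_le_sup_lt1.
  by apply: ge_ereal_sup => _ [g bg <-]; exact: renyi_obj_le_lt1.
rewrite negb_and -!leNgt => a_out.
case: ifPn => [a1|]; first exact: renyi_eq_sup_gt1.
rewrite -leNgt => a_le1.
have a_lt0 : (a < 0)%R.
  case/orP: a_out => [a_le0|a_ge1]; first by rewrite lt_neqAle ha0.
  by move: ha1; rewrite eq_le a_le1 a_ge1.
(* The remaining branch of [renyi] is the formula of order [1 - a > 1] with [P] and [Q] exchanged,
   the same exchange that [renyi_sup_swap] makes in the supremum. *)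
rewrite a_lt0 renyi_sup_swap; apply: renyi_eq_sup_gt1 => //.
by rewrite ltrDl oppr_gt0.
Qed.
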